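(* Let $l>0$, $g>0$, $T>0$ and let $f\colon\mathbb{R}\to\mathbb{R}$ be a smooth $T$-periodic function. Consider the system $$\dot\varphi = p,\qquad \dot p = \frac{g}{l}\sin\varphi-\frac{\ddot f(t)}{l}\cos\varphi .$$ Then there exist $\varphi_0$ and $p_0$ such that for all $t\in\mathbb{R}$: (1) $\varphi(t,0,\varphi_0,p_0)=\varphi(t+T,0,\varphi_0,p_0)$ and $p(t,0,\varphi_0,p_0)=p(t+T,0,\varphi_0,p_0)$; (2) $\varphi(t,0,\varphi_0,p_0)\in(-\pi/2,\pi/2)$.
   Context: The system describes an inverted planar pendulum of length $l$ (massless rod, point mass at its end) under gravity with gravitational constant $g$, whose pivot point moves along a horizontal line according to the law $f(t)$. The horizontal positions of the rod are $\varphi=\pm\pi/2$, and the position of the point mass is $x=f+l\sin\varphi$, $y=l\cos\varphi$. Dots denote derivatives in $t$. The variable $\varphi$ is an angle, i.e. it is taken modulo $2\pi$, so the phase space is $(\mathbb{R}/2\pi\mathbb{Z})\times\mathbb{R}$. The interval $(-\pi/2,\pi/2)$ is identified with its image in $\mathbb{R}/2\pi\mathbb{Z}$. The notation $t\mapsto(\varphi(t,0,\varphi_0,p_0),p(t,0,\varphi_0,p_0))$ stands for the solution of the system with initial time $0$ and with $\varphi=\varphi_0$, $p=p_0$ at $t=0$. *)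

(* Defs.v *)
From Stdlib Require Import Reals Lra ZArith.
From Stdlib Require Import FunctionalExtensionality PropExtensionality ProofIrrelevance.
From Coquelicot Require Import Coquelicot.
Open Scope R_scope.

Definition coset (x : R) : R -> Prop :=
  fun y => exists k : Z, y = x + 2 * PI * IZR k.

(* R / 2 pi Z, as the type of cosets of 2 pi Z in R. *)
Definition circle : Type := {A : R -> Prop | exists x, A = coset x}.

Definition angle (x : R) : circle :=
  exist _ (coset x) (ex_intro _ x eq_refl).

Lemma angle_eq (x y : R) :
  angle x = angle y <-> exists k : Z, y = x + 2 * PI * IZR k.
Proof.
  split.
  - intros H. apply (f_equal (fun a => proj1_sig a)) in H. simpl in H.
    change (coset x y). rewrite H. exists 0%Z. lra.
  - intros [k Hk].
    assert (E : coset x = coset y).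
    { apply functional_extensionality; intros z.
      apply propositional_extensionality; split; intros [m Hm].
      - exists (m - k)%Z. rewrite minus_IZR, Hm, Hk. ring.
      - exists (m + k)%Z. rewrite plus_IZR, Hm, Hk. ring. }
    unfold angle. apply eq_sig_hprop; [intros; apply proof_irrelevance | exact E].
Qed.

Lemma angle_surj (a : circle) : exists x, a = angle x.
Proof.
  destruct a as [A [x Hx]]. exists x.
  apply eq_sig_hprop; [intros; apply proof_irrelevance | exact Hx].
Qed.

Definition smooth (f : R -> R) : Prop :=
  forall (n : nat) (t : R), ex_derive_n f n t.

Definition periodic (T : R) (f : R -> R) : Prop :=
  forall t, f (t + T) = f t.

(* A differentiable curve in R / 2 pi Z is the projection of a differentiable
   real-valued curve [x], and its velocity is that of [x]; the right-hand side
   depends on [x] only modulo 2 pi. *)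
Definition is_solution (l g : R) (f : R -> R)
    (phi : R -> circle) (p : R -> R) : Prop :=
  exists x : R -> R,
    (forall t, phi t = angle (x t)) /\
    (forall t, is_derive x t (p t)) /\
    (forall t, is_derive p t
       (g / l * sin (x t) - Derive_n f 2 t / l * cos (x t))).

(* [(phi, p)] is the (one and only) solution, defined on all of R, that takes
   the value [(phi0, p0)] at time [t0]. *)
Definition is_the_solution (l g : R) (f : R -> R)
    (t0 : R) (phi0 : circle) (p0 : R) (phi : R -> circle) (p : R -> R) : Prop :=
  (is_solution l g f phi p /\ phi t0 = phi0 /\ p t0 = p0) /\
  (forall (psi : R -> circle) (q : R -> R),
     is_solution l g f psi q -> psi t0 = phi0 -> q t0 = p0 ->
     forall t, psi t = phi t /\ q t = p t).

(* The image of (-pi/2, pi/2) in R / 2 pi Z. *)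
Definition upper_arc (a : circle) : Prop :=
  exists x : R, - (PI / 2) < x < PI / 2 /\ a = angle x.

(* Main.v *)
(** Write the equation as [x'' = F t x], with [F] [T]-periodic in [t] and [K]-Lipschitz in [x].
    If [M] bounds [|f''|] and [a = atan (M / g)], then [F t (-a) <= 0 <= F t a]: the constants
    [-a] and [a] are a lower and an upper solution of the periodic problem.  For [k ^ 2 >= K] the
    forcing [F t u - k ^ 2 * u] decreases in [u].  The equation is equivalent to the system
    [u' = - k u + v], [v' = k v + (F t u - k ^ 2 u)], in which the periodic response [u] increases
    with [v], and the periodic response [v] decreases with the forcing.  Starting from [u = -a],
    the iteration therefore increases, stays in [[-a, a]], and converges to a [T]-periodic
    solution, which lies in [(-PI/2, PI/2)] since [a < PI/2]. *)

Require Import Defs.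
From Stdlib Require Import Reals Lra.
From Coquelicot Require Import Coquelicot.
Open Scope R_scope.

(** * Mean values, Lipschitz functions and limits of derivatives *)

Lemma is_derive_continuity_pt (f : R -> R) (x df : R) :
  is_derive f x df -> continuity_pt f x.
Proof.
  intros H. apply continuity_pt_filterlim.
  apply (ex_derive_continuous f x). exists df. exact H.
Qed.

(* [auto_derive] leaves eta-expanded derivatives, on which [is_derive_unique] cannot rewrite. *)
Lemma is_derive_unique_eta (f : R -> R) (x df : R) :
  is_derive f x df -> Derive (fun y => f y) x = df.
Proof. apply is_derive_unique. Qed.

Lemma mean_value (f df : R -> R) (a b : R) :
  (forall t, is_derive f t (df t)) ->
  exists c, Rmin a b <= c <= Rmax a b /\ f b - f a = df c * (b - a).
Proof.
  intros H. apply MVT_gen; intros; [apply H | eapply is_derive_continuity_pt, H].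
Qed.

Lemma derive_nonneg_le (f df : R -> R) (a b : R) :
  (forall t, is_derive f t (df t)) -> (forall t, 0 <= df t) ->
  a <= b -> f a <= f b.
Proof.
  intros H Hp Hab. destruct (mean_value f df a b H) as [c [_ Hc]].
  specialize (Hp c). nra.
Qed.

Definition lipschitz (L : R) (h : R -> R) : Prop :=
  forall s t, Rabs (h s - h t) <= L * Rabs (s - t).

Lemma derive_bounded_lipschitz (h dh : R -> R) (L : R) :
  (forall t, is_derive h t (dh t)) -> (forall t, Rabs (dh t) <= L) ->
  lipschitz L h.
Proof.
  intros H Hb s t. destruct (mean_value h dh t s H) as [c [_ Hc]].
  rewrite Hc, Rabs_mult. apply Rmult_le_compat_r; [apply Rabs_pos | apply Hb].
Qed.

Lemma lipschitz_continuous (L : R) (h : R -> R) (x : R) :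
  lipschitz L h -> continuous h x.
Proof.
  intros H. apply continuity_pt_filterlim. intros eps Heps.
  (* [L] may be zero or negative; [Rabs L + 1] is a positive constant to divide by. *)
  assert (HL : 0 < Rabs L + 1) by (pose proof (Rabs_pos L); lra).
  exists (eps / (Rabs L + 1)). split; [apply Rdiv_lt_0_compat; lra|].
  intros y [_ Hy]. simpl in *. unfold R_dist in *.
  apply Rle_lt_trans with (1 := H y x).
  apply Rle_lt_trans with ((Rabs L + 1) * Rabs (y - x)).
  - pose proof (Rabs_pos (y - x)). pose proof (Rle_abs L). nra.
  - apply Rlt_le_trans with ((Rabs L + 1) * (eps / (Rabs L + 1))).
    + apply Rmult_lt_compat_l; lra.
    + right. field. lra.
Qed.

Lemma Rabs_between_Rle (a b c : R) :
  Rmin a b <= c <= Rmax a b -> Rabs (c - a) <= Rabs (b - a).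
Proof.
  unfold Rmin, Rmax, Rabs. intros [H1 H2].
  destruct (Rle_dec a b), (Rcase_abs (c - a)), (Rcase_abs (b - a)); lra.
Qed.

(* Equi-Lipschitz derivatives make the first-order Taylor remainder quadratic uniformly in [n], so the estimate survives pointwise limits. *)
Lemma is_derive_lim_seq (w d : nat -> R -> R) (w' d' : R -> R) (L : R) :
  (forall n t, is_derive (w n) t (d n t)) -> (forall n, lipschitz L (d n)) ->
  (forall t, is_lim_seq (fun n => w n t) (w' t)) ->
  (forall t, is_lim_seq (fun n => d n t) (d' t)) ->
  forall t, is_derive w' t (d' t).
Proof.
  intros Hd HL Hw Hd' t.
  assert (Q : forall s, Rabs (w' s - w' t - d' t * (s - t)) <= Rabs L * Rabs (s - t) ^ 2).
  { intros s.
    apply (is_lim_seq_le (fun n => Rabs (w n s - w n t - d n t * (s - t)))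
             (fun _ => Rabs L * Rabs (s - t) ^ 2)
             (Rabs (w' s - w' t - d' t * (s - t))) (Rabs L * Rabs (s - t) ^ 2)).
    - intros n. destruct (mean_value (w n) (d n) t s (Hd n)) as [c [Hc E]].
      rewrite E. replace (d n c * (s - t) - d n t * (s - t))
        with ((d n c - d n t) * (s - t)) by ring.
      rewrite Rabs_mult. apply Rabs_between_Rle in Hc.
      pose proof (HL n c t). pose proof (Rle_abs L).
      pose proof (Rabs_pos (c - t)). pose proof (Rabs_pos (s - t)).
      pose proof (Rabs_pos L).
      assert (Rabs (d n c - d n t) <= Rabs L * Rabs (s - t)).
      { apply Rle_trans with (Rabs L * Rabs (c - t)); nra. }
      simpl. rewrite Rmult_1_r, <- Rmult_assoc.
      apply Rmult_le_compat_r; assumption.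
    - apply (is_lim_seq_abs _ (Finite (w' s - w' t - d' t * (s - t)))).
      apply is_lim_seq_minus'; [apply is_lim_seq_minus'; apply Hw|].
      apply is_lim_seq_mult'; [apply Hd' | apply is_lim_seq_const].
    - apply is_lim_seq_const. }
  (* By [Q] the difference quotient is off by at most [Rabs L * Rabs h], so [eps / (Rabs L + 1)]
     serves as the radius. *)
  apply is_derive_Reals. intros eps Heps.
  assert (HL' : 0 < Rabs L + 1) by (pose proof (Rabs_pos L); lra).
  exists (mkposreal _ (Rdiv_lt_0_compat _ _ Heps HL')).
  intros h Hh Hlt. simpl in Hlt.
  specialize (Q (t + h)). replace (t + h - t) with h in Q by ring.
  replace ((w' (t + h) - w' t) / h - d' t)
    with ((w' (t + h) - w' t - d' t * h) / h) by (field; exact Hh).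
  unfold Rdiv. rewrite Rabs_mult, Rabs_inv.
  pose proof (Rabs_pos_lt h Hh).
  apply Rmult_lt_reg_r with (Rabs h); [assumption|].
  rewrite Rmult_assoc, Rinv_l, Rmult_1_r by lra.
  apply Rle_lt_trans with (1 := Q).
  assert (Rabs h * (Rabs L + 1) < eps).
  { apply Rmult_lt_reg_r with (/ (Rabs L + 1)); [apply Rinv_0_lt_compat; lra|].
    rewrite Rmult_assoc, Rinv_r, Rmult_1_r by lra. exact Hlt. }
  simpl. nra.
Qed.

(** * Gronwall's inequality and uniqueness for second-order equations *)

(** [E s * exp (- c * s)] is nonincreasing and [E s * exp (c * s)] is nondecreasing; the first
    settles the times after [t0], the second those before it. *)
Lemma gronwall_zero (E dE : R -> R) (c t0 : R) :
  (forall t, is_derive E t (dE t)) -> (forall t, 0 <= E t) ->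
  (forall t, Rabs (dE t) <= c * E t) -> E t0 = 0 -> forall t, E t = 0.
Proof.
  intros H Hpos Hb H0 t.
  assert (B : forall s, - (c * E s) <= dE s <= c * E s).
  { intros s. apply Rabs_le_between, Hb. }
  apply Rle_antisym; [|apply Hpos].
  destruct (Rle_dec t0 t) as [Ht|Ht].
  - assert (D : - (E t0 * exp (- c * t0)) <= - (E t * exp (- c * t))).
    { apply (derive_nonneg_le (fun s => - (E s * exp (- c * s)))
               (fun s => (c * E s - dE s) * exp (- c * s))); [| |exact Ht].
      - intros s. auto_derive; [exists (dE s); apply H|].
        rewrite (is_derive_unique_eta _ _ _ (H s)). ring.
      - intros s. apply Rmult_le_pos; [specialize (B s); lra | left; apply exp_pos]. }
    rewrite H0 in D. pose proof (exp_pos (- c * t)). nra.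
  - assert (D : E t * exp (c * t) <= E t0 * exp (c * t0)).
    { apply (derive_nonneg_le (fun s => E s * exp (c * s))
               (fun s => (c * E s + dE s) * exp (c * s))); [| |lra].
      - intros s. auto_derive; [exists (dE s); apply H|].
        rewrite (is_derive_unique_eta _ _ _ (H s)). ring.
      - intros s. apply Rmult_le_pos; [specialize (B s); lra | left; apply exp_pos]. }
    rewrite H0 in D. pose proof (exp_pos (c * t)). nra.
Qed.

(** Gronwall applies to the squared distance in the phase plane; [2 |a| |b| <= a ^ 2 + b ^ 2] yields
    the rate [1 + Rabs K]. *)
Lemma second_order_unique (F : R -> R -> R) (K t0 : R) (x p y q : R -> R) :
  (forall t, lipschitz K (F t)) ->
  (forall t, is_derive x t (p t)) -> (forall t, is_derive p t (F t (x t))) ->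
  (forall t, is_derive y t (q t)) -> (forall t, is_derive q t (F t (y t))) ->
  y t0 = x t0 -> q t0 = p t0 -> forall t, y t = x t /\ q t = p t.
Proof.
  intros HK Hx Hp Hy Hq Exy Epq t.
  assert (Z : (y t - x t) ^ 2 + (q t - p t) ^ 2 = 0).
  { apply (gronwall_zero (fun s => (y s - x s) ^ 2 + (q s - p s) ^ 2)
      (fun s => 2 * (y s - x s) * (q s - p s)
                + 2 * (q s - p s) * (F s (y s) - F s (x s))) (1 + Rabs K) t0).
    - intros s. auto_derive.
      + repeat split; eexists; [apply Hy | apply Hx | apply Hq | apply Hp].
      + rewrite (is_derive_unique_eta _ _ _ (Hx s)), (is_derive_unique_eta _ _ _ (Hy s)),
          (is_derive_unique_eta _ _ _ (Hp s)), (is_derive_unique_eta _ _ _ (Hq s)). ring.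
    - intros s. apply Rplus_le_le_0_compat; apply pow2_ge_0.
    - intros s. set (a := y s - x s). set (b := q s - p s).
      assert (D : Rabs (F s (y s) - F s (x s)) <= Rabs K * Rabs a).
      { apply Rle_trans with (1 := HK s (y s) (x s)). fold a.
        apply Rmult_le_compat_r; [apply Rabs_pos | apply Rle_abs]. }
      apply Rle_trans with (2 * Rabs a * Rabs b + 2 * Rabs b * (Rabs K * Rabs a)).
      + eapply Rle_trans; [apply Rabs_triang|].
        rewrite !Rabs_mult, (Rabs_pos_eq 2) by lra.
        pose proof (Rabs_pos b). pose proof (Rabs_pos a). nra.
      + rewrite <- (pow2_abs a), <- (pow2_abs b).
        pose proof (Rabs_pos K). pose proof (pow2_ge_0 (Rabs a - Rabs b)). nra.
    - rewrite Exy, Epq. ring. }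
  rewrite <- !Rsqr_pow2 in Z. apply Rplus_sqr_eq_0 in Z. lra.
Qed.

(** * Periodic solutions of first-order linear equations *)

(* The constant of integration is the one that makes the solution of [v' = lam v + q] periodic (for [lam <> 0]). *)
Definition periodic_response (T lam : R) (q : R -> R) (t : R) : R :=
  let I := RInt (fun s => exp (- lam * s) * q s) 0 in
  exp (lam * t) * (exp (lam * T) * I T / (1 - exp (lam * T)) + I t).

Lemma is_derive_periodic_response (T lam : R) (q : R -> R) (t : R) :
  (forall s, continuous q s) ->
  is_derive (periodic_response T lam q) t (lam * periodic_response T lam q t + q t).
Proof.
  intros Hq. unfold periodic_response.
  (* The term [exp (lam * t) * C] solves the homogeneous equation whatever the constant [C] is. *)
  set (C := _ / _). set (h := fun s => exp (- lam * s) * q s).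
  assert (Hh : forall s, continuous h s).
  { intros s. apply (continuous_mult (fun s => exp (- lam * s)) q); [|apply Hq].
    apply (ex_derive_continuous (fun s => exp (- lam * s))). auto_derive. exact I. }
  assert (D : is_derive (RInt h 0) t (h t)).
  { apply (is_derive_RInt h (RInt h 0) 0 t); [|apply Hh].
    apply filter_forall. intros b. apply (RInt_correct h 0 b).
    apply (ex_RInt_continuous h). intros; apply Hh. }
  set (I := RInt h 0) in *. clearbody I.
  auto_derive; [exists (h t); exact D|].
  rewrite (is_derive_unique_eta _ _ _ D). unfold h.
  replace (exp (- lam * t)) with (/ exp (lam * t)).
  - field. pose proof (exp_pos (lam * t)). lra.
  - rewrite <- exp_Ropp. f_equal. ring.
Qed.

Lemma exp_mult_ne_1 (lam T : R) : lam <> 0 -> 0 < T -> exp (lam * T) <> 1.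
Proof.
  intros Hl HT E. rewrite <- exp_0 in E. apply exp_inv in E. nra.
Qed.

Lemma is_derive_shift (h : R -> R) (T t dh : R) :
  is_derive h (t + T) dh -> is_derive (fun s => h (s + T)) t dh.
Proof.
  intros H. auto_derive; [exists dh; exact H|].
  rewrite (is_derive_unique_eta _ _ _ H). ring.
Qed.

(** The response and its translate by [T] solve the same equation, so their difference solves the
    homogeneous one and vanishes as soon as it does at [0]. Squaring makes it nonnegative, as
    [gronwall_zero] requires. *)
Lemma periodic_periodic_response (T lam : R) (q : R -> R) :
  lam <> 0 -> 0 < T -> (forall s, continuous q s) -> periodic T q ->
  periodic T (periodic_response T lam q).
Proof.
  intros Hl HT Hq Hp t. set (v := periodic_response T lam q).
  assert (D : forall s, is_derive v s (lam * v s + q s))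
    by (intros s; apply is_derive_periodic_response, Hq).
  assert (DT : forall s, is_derive (fun s => v (s + T)) s (lam * v (s + T) + q s)).
  { intros s. rewrite <- (Hp s). apply is_derive_shift, D. }
  assert (Z : (v (t + T) - v t) ^ 2 = 0).
  { apply (gronwall_zero (fun s => (v (s + T) - v s) ^ 2)
             (fun s => 2 * lam * (v (s + T) - v s) ^ 2) (2 * Rabs lam) 0).
    - intros s. pose proof (D (s + T)) as Es. pose proof (D s) as E.
      auto_derive; [repeat split; eexists; eassumption|].
      rewrite (is_derive_unique_eta _ _ _ Es), (is_derive_unique_eta _ _ _ E), (Hp s). ring.
    - intros s. apply pow2_ge_0.
    - intros s. rewrite !Rabs_mult, (Rabs_pos_eq 2), (Rabs_pos_eq (_ ^ 2))
        by (apply pow2_ge_0 || lra). lra.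
    (* Here the constant of integration counts: it gives [v T = v 0]. *)
    - unfold v, periodic_response. rewrite Rplus_0_l, Rmult_0_r, exp_0, RInt_point.
      change zero with 0.
      pose proof (exp_mult_ne_1 lam T Hl HT). field. lra. }
  nra.
Qed.

(* Integrating [(exp (- lam t) (v2 - v1))' >= 0] over one period gives [(v2 - v1) (1 - exp (- lam T)) <= 0]. *)
Lemma periodic_linear_compare (T lam : R) (v1 v2 q1 q2 : R -> R) :
  lam <> 0 -> 0 < T -> periodic T v1 -> periodic T v2 ->
  (forall t, is_derive v1 t (lam * v1 t + q1 t)) ->
  (forall t, is_derive v2 t (lam * v2 t + q2 t)) ->
  (forall t, q1 t <= q2 t) -> forall t, lam * v2 t <= lam * v1 t.
Proof.
  intros Hl HT P1 P2 D1 D2 Hq t.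
  assert (M : exp (- lam * t) * (v2 t - v1 t)
              <= exp (- lam * (t + T)) * (v2 (t + T) - v1 (t + T))).
  { apply (derive_nonneg_le (fun s => exp (- lam * s) * (v2 s - v1 s))
             (fun s => exp (- lam * s) * (q2 s - q1 s))); [| |lra].
    - intros s. pose proof (D1 s) as E1. pose proof (D2 s) as E2.
      auto_derive; [repeat split; eexists; eassumption|].
      rewrite (is_derive_unique_eta _ _ _ E1), (is_derive_unique_eta _ _ _ E2). ring.
    - intros s. apply Rmult_le_pos; [left; apply exp_pos | specialize (Hq s); lra]. }
  rewrite P1, P2, Rmult_plus_distr_l, exp_plus in M.
  pose proof (exp_pos (- lam * t)).
  assert (M' : (v2 t - v1 t) * (1 - exp (- lam * T)) <= 0) by nra.
  assert (N : lam * (v2 t - v1 t) <= 0); [|lra].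
  (* [1 - exp (- lam * T)] has the sign of [lam], so the factor [lam] in the conclusion covers both
     cases. *)
  destruct (Rdichotomy _ _ Hl) as [Hn|Hn].
  - assert (1 < exp (- lam * T)) by (rewrite <- exp_0; apply exp_increasing; nra). nra.
  - assert (exp (- lam * T) < 1) by (rewrite <- exp_0; apply exp_increasing; nra). nra.
Qed.

(** * Monotone iteration between a lower and an upper solution *)

Section PeriodicMonotoneIteration.

Variables (F : R -> R -> R) (T L K k alpha beta : R).
Hypotheses
  (T_pos : 0 < T) (k_pos : 0 < k) (K_le : K <= k ^ 2) (alpha_le : alpha <= beta)
  (F_periodic : forall x, periodic T (fun t => F t x))
  (F_lip_t : forall x, lipschitz L (fun t => F t x))
  (F_lip_x : forall t, lipschitz K (F t))
  (F_lower : forall t, F t alpha <= 0) (F_upper : forall t, 0 <= F t beta).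

Definition forcing (u : R -> R) (t : R) : R := F t (u t) - k ^ 2 * u t.

Definition half_step (u : R -> R) : R -> R := periodic_response T k (forcing u).

(** For admissible [u] this is the [T]-periodic solution [w] of [w'' - k ^ 2 * w = forcing u]: the
    operator factors as [(d/dt - k) (d/dt + k)], and [half_step] inverts the first factor. *)
Definition step (u : R -> R) : R -> R := periodic_response T (- k) (half_step u).

Fixpoint iterate (n : nat) : R -> R :=
  match n with
  | O => fun _ => alpha
  | S m => step (iterate m)
  end.

(** The Lipschitz constant is existential because it only serves to make [forcing u] continuous;
    constants uniform in [u] come from [step_lipschitz] and [half_step_lipschitz]. *)
Definition admissible (u : R -> R) : Prop :=
  (exists C, lipschitz C u) /\ periodic T u /\ (forall t, alpha <= u t <= beta).

Lemma K_nonneg : 0 <= K.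
Proof.
  pose proof (F_lip_x 0 1 0) as H. pose proof (Rabs_pos (F 0 1 - F 0 0)).
  rewrite Rminus_0_r, Rabs_R1 in H. lra.
Qed.

(** The Lipschitz bound from [alpha], where [F] is nonpositive, limits [F] from above; the one from
    [beta], where [F] is nonnegative, limits it from below. *)
Lemma F_bounded (t x : R) : alpha <= x <= beta -> Rabs (F t x) <= K * (beta - alpha).
Proof.
  intros Hx. pose proof K_nonneg.
  pose proof (F_lip_x t x alpha) as H1. pose proof (F_lip_x t beta x) as H2.
  rewrite (Rabs_pos_eq (x - alpha)) in H1 by lra.
  rewrite (Rabs_pos_eq (beta - x)) in H2 by lra.
  apply Rabs_le_between in H1. apply Rabs_le_between in H2.
  pose proof (F_lower t). pose proof (F_upper t).
  apply Rabs_le. nra.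
Qed.

Lemma forcing_lipschitz (u : R -> R) (C : R) :
  lipschitz C u -> lipschitz (L + K * C + k ^ 2 * C) (forcing u).
Proof.
  intros Hu s t. unfold forcing.
  replace (F s (u s) - k ^ 2 * u s - (F t (u t) - k ^ 2 * u t))
    with ((F s (u s) - F t (u s)) + (F t (u s) - F t (u t)) + - (k ^ 2 * (u s - u t))) by ring.
  pose proof (Hu s t). pose proof (F_lip_t (u s) s t). pose proof (F_lip_x t (u s) (u t)).
  pose proof K_nonneg. pose proof (pow2_ge_0 k).
  eapply Rle_trans; [apply Rabs_triang|].
  eapply Rle_trans; [apply Rplus_le_compat_r, Rabs_triang|].
  rewrite Rabs_Ropp, Rabs_mult, (Rabs_pos_eq (k ^ 2)) by assumption.
  simpl in *. nra.
Qed.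

(** [F t] grows with slope at most [K], and [K <= k ^ 2]. *)
Lemma forcing_anti (u w : R -> R) (t : R) :
  u t <= w t -> forcing w t <= forcing u t.
Proof.
  intros H. unfold forcing. pose proof (F_lip_x t (w t) (u t)) as D.
  rewrite (Rabs_pos_eq (w t - u t)) in D by lra.
  apply Rabs_le_between in D. nra.
Qed.

Lemma is_derive_half_step (u : R -> R) (t : R) :
  admissible u -> is_derive (half_step u) t (k * half_step u t + forcing u t).
Proof.
  intros [[C HC] _]. apply is_derive_periodic_response. intros s.
  eapply lipschitz_continuous, forcing_lipschitz, HC.
Qed.

Lemma periodic_half_step (u : R -> R) : admissible u -> periodic T (half_step u).
Proof.
  intros [[C HC] [HT _]]. apply periodic_periodic_response; try lra.
  - intros s. eapply lipschitz_continuous, forcing_lipschitz, HC.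
  - intros s. unfold forcing. rewrite HT. f_equal. apply F_periodic.
Qed.

Lemma is_derive_step (u : R -> R) (t : R) :
  admissible u -> is_derive (step u) t (- k * step u t + half_step u t).
Proof.
  intros Hu. apply is_derive_periodic_response. intros s.
  apply (ex_derive_continuous (half_step u)).
  eexists. apply is_derive_half_step, Hu.
Qed.

Lemma periodic_step (u : R -> R) : admissible u -> periodic T (step u).
Proof.
  intros Hu. apply periodic_periodic_response; try lra.
  - intros s. apply (ex_derive_continuous (half_step u)).
    eexists. apply is_derive_half_step, Hu.
  - apply periodic_half_step, Hu.
Qed.

(** Exhibits a constant as the response to a constant forcing, so that barriers can enter
    [periodic_linear_compare]. *)
Lemma is_derive_const_response (lam c t : R) :
  is_derive (fun _ : R => c) t (lam * c + - (lam * c)).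
Proof. rewrite Rplus_opp_r. apply (is_derive_const c t). Qed.

(** Since [u] lies above [alpha], [forcing u] is at most [- k ^ 2 * alpha], whose response at rate
    [k] is the constant [k * alpha]; the bound with [beta] is symmetric. *)
Lemma half_step_bounds (u : R -> R) (t : R) :
  admissible u -> k * alpha <= half_step u t <= k * beta.
Proof.
  intros Hu. pose proof Hu as [_ [_ Hb]].
  assert (k_ne : k <> 0) by lra. split; apply Rmult_le_reg_l with k; try exact k_pos.
  - apply (periodic_linear_compare T k (half_step u) (fun _ => k * alpha)
             (forcing u) (fun _ => - (k * (k * alpha)))); try assumption.
    + apply periodic_half_step, Hu.
    + intros s; reflexivity.
    + intros s. apply is_derive_half_step, Hu.
    + intros s. apply is_derive_const_response.
    + intros s. eapply Rle_trans; [apply (forcing_anti (fun _ => alpha)), Hb|].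
      unfold forcing. pose proof (F_lower s). lra.
  - apply (periodic_linear_compare T k (fun _ => k * beta) (half_step u)
             (fun _ => - (k * (k * beta))) (forcing u)); try assumption.
    + intros s; reflexivity.
    + apply periodic_half_step, Hu.
    + intros s. apply is_derive_const_response.
    + intros s. apply is_derive_half_step, Hu.
    + intros s. eapply Rle_trans; [|apply (forcing_anti _ (fun _ => beta)), Hb].
      unfold forcing. pose proof (F_upper s). lra.
Qed.

Lemma step_bounds (u : R -> R) (t : R) :
  admissible u -> alpha <= step u t <= beta.
Proof.
  intros Hu. assert (k_ne : - k <> 0) by lra.
  (* At rate [- k] the comparison yields inequalities between [- k] multiples, so the goals are
     brought to that form. *)
  split; apply Rmult_le_reg_l with k; try exact k_pos; apply Ropp_le_cancel;
    rewrite !Ropp_mult_distr_l.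
  - apply (periodic_linear_compare T (- k) (fun _ => alpha) (step u)
             (fun _ => - (- k * alpha)) (half_step u)); try assumption.
    + intros s; reflexivity.
    + apply periodic_step, Hu.
    + intros s. apply is_derive_const_response.
    + intros s. apply is_derive_step, Hu.
    + intros s. pose proof (half_step_bounds u s Hu). lra.
  - apply (periodic_linear_compare T (- k) (step u) (fun _ => beta)
             (half_step u) (fun _ => - (- k * beta))); try assumption.
    + apply periodic_step, Hu.
    + intros s; reflexivity.
    + intros s. apply is_derive_step, Hu.
    + intros s. apply is_derive_const_response.
    + intros s. pose proof (half_step_bounds u s Hu). lra.
Qed.

(** Two reversals of order cancel: that of [forcing] and that of the response at the positive rate
    [k]. *)
Lemma half_step_mono (u w : R -> R) (t : R) :
  admissible u -> admissible w -> (forall s, u s <= w s) ->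
  half_step u t <= half_step w t.
Proof.
  intros Hu Hw Huw. apply Rmult_le_reg_l with k; [exact k_pos|].
  apply (periodic_linear_compare T k (half_step w) (half_step u)
           (forcing w) (forcing u)); try lra.
  - apply periodic_half_step, Hw.
  - apply periodic_half_step, Hu.
  - intros s. apply is_derive_half_step, Hw.
  - intros s. apply is_derive_half_step, Hu.
  - intros s. apply forcing_anti, Huw.
Qed.

Lemma step_mono (u w : R -> R) (t : R) :
  admissible u -> admissible w -> (forall s, u s <= w s) -> step u t <= step w t.
Proof.
  intros Hu Hw Huw. apply Rmult_le_reg_l with k; [exact k_pos|].
  apply Ropp_le_cancel. rewrite !Ropp_mult_distr_l.
  apply (periodic_linear_compare T (- k) (step u) (step w)
           (half_step u) (half_step w)); try lra.
  - apply periodic_step, Hu.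
  - apply periodic_step, Hw.
  - intros s. apply is_derive_step, Hu.
  - intros s. apply is_derive_step, Hw.
  - intros s. apply half_step_mono; assumption.
Qed.

(** The derivative is the difference of [half_step u] and [k * step u], which both lie in
    [[k * alpha, k * beta]]. The constant is independent of [u], as the passage to the limit
    demands. *)
Lemma step_lipschitz (u : R -> R) :
  admissible u -> lipschitz (k * (beta - alpha)) (step u).
Proof.
  intros Hu. eapply derive_bounded_lipschitz.
  - intros t. apply is_derive_step, Hu.
  - intros t. pose proof (step_bounds u t Hu). pose proof (half_step_bounds u t Hu).
    apply Rabs_le. nra.
Qed.

(** The derivative is [k * (half_step u t - k * u t) + F t (u t)]; the first term contributes
    [k ^ 2] and the second, by [F_bounded], contributes [K]. *)
Lemma half_step_lipschitz (u : R -> R) :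
  admissible u -> lipschitz ((K + k ^ 2) * (beta - alpha)) (half_step u).
Proof.
  intros Hu. eapply derive_bounded_lipschitz.
  - intros t. apply is_derive_half_step, Hu.
  - intros t. pose proof (half_step_bounds u t Hu). pose proof Hu as [_ [_ Hb]].
    specialize (Hb t). pose proof (F_bounded t (u t) Hb) as HF.
    apply Rabs_le_between in HF. unfold forcing. apply Rabs_le. nra.
Qed.

Lemma iterate_admissible (n : nat) : admissible (iterate n).
Proof.
  induction n as [|n IH]; simpl.
  - split; [|split].
    + exists 0. intros s t. rewrite Rminus_diag, Rabs_R0. lra.
    + intros t; reflexivity.
    + intros t. lra.
  - split; [|split].
    + eexists. apply step_lipschitz, IH.
    + apply periodic_step, IH.
    + intros t. apply step_bounds, IH.
Qed.

Lemma iterate_incr (n : nat) : forall t, iterate n t <= iterate (S n) t.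
Proof.
  induction n as [|n IH]; intros t.
  (* The iteration starts at the lower barrier [alpha], below which no step falls. *)
  - apply (step_bounds (iterate 0) t (iterate_admissible 0)).
  - apply step_mono; [| apply (iterate_admissible (S n)) | exact IH].
    apply iterate_admissible.
Qed.

Lemma iterate_lipschitz (n : nat) : lipschitz (k * (beta - alpha)) (iterate n).
Proof.
  destruct n as [|n]; [|apply step_lipschitz, iterate_admissible].
  intros s t. simpl. rewrite Rminus_diag, Rabs_R0.
  apply Rmult_le_pos; [nra | apply Rabs_pos].
Qed.

(** Both components of the iteration increase and are bounded, hence converge pointwise; the uniform
    Lipschitz bounds let [is_derive_lim_seq] carry the first-order system to the limit. *)
Lemma periodic_solution_between :
  exists x p : R -> R,
    (forall t, is_derive x t (p t)) /\ (forall t, is_derive p t (F t (x t))) /\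
    periodic T x /\ periodic T p /\ (forall t, alpha <= x t <= beta).
Proof.
  pose proof iterate_admissible as A.
  set (U := iterate). set (V := fun n => half_step (iterate n)).
  (* [real] sends infinite limits to [0]; [Hu] and [Hv] show that the limits are finite. *)
  set (u := fun t => real (Lim_seq (fun n => U n t))).
  set (v := fun t => real (Lim_seq (fun n => V n t))).
  assert (Hu : forall t, is_lim_seq (fun n => U n t) (u t)).
  { intros t. apply Lim_seq_correct'. apply (ex_finite_lim_seq_incr _ beta).
    - intros n. apply iterate_incr.
    - intros n. apply (A n). }
  assert (Hv : forall t, is_lim_seq (fun n => V n t) (v t)).
  { intros t. apply Lim_seq_correct'. apply (ex_finite_lim_seq_incr _ (k * beta)).
    - intros n. apply half_step_mono; [apply A .. | apply iterate_incr].
    - intros n. apply half_step_bounds, A. }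
  (* The shift is needed because [V n] drives [U (S n)], not [U n]. *)
  assert (HuS : forall t, is_lim_seq (fun n => U (S n) t) (u t)).
  { intros t. apply (is_lim_seq_incr_1 (fun n => U n t)), Hu. }
  assert (Du : forall t, is_derive u t (- k * u t + v t)).
  { apply (is_derive_lim_seq (fun n => U (S n)) (fun n t => - k * U (S n) t + V n t)
      u (fun t => - k * u t + v t)
      (k * (k * (beta - alpha)) + (K + k ^ 2) * (beta - alpha))).
    - intros n t. apply is_derive_step, A.
    - intros n s t.
      pose proof (iterate_lipschitz (S n) s t) as H1.
      pose proof (half_step_lipschitz (iterate n) (A n) s t) as H2.
      fold U in H1. fold (V n) in H2.
      replace (- k * U (S n) s + V n s - (- k * U (S n) t + V n t))
        with (- (k * (U (S n) s - U (S n) t)) + (V n s - V n t)) by ring.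
      eapply Rle_trans; [apply Rabs_triang|].
      rewrite Rabs_Ropp, Rabs_mult, (Rabs_pos_eq k) by lra. nra.
    - exact HuS.
    - intros t. apply is_lim_seq_plus'; [|apply Hv].
      apply is_lim_seq_mult'; [apply is_lim_seq_const | apply HuS]. }
  assert (Dv : forall t, is_derive v t (k * v t + (F t (u t) - k ^ 2 * u t))).
  { set (B := k * (beta - alpha)).
    apply (is_derive_lim_seq V (fun n t => k * V n t + forcing (U n) t)
      v (fun t => k * v t + (F t (u t) - k ^ 2 * u t))
      (k * ((K + k ^ 2) * (beta - alpha)) + (L + K * B + k ^ 2 * B))).
    - intros n t. apply is_derive_half_step, A.
    - intros n s t.
      pose proof (forcing_lipschitz (U n) B (iterate_lipschitz n) s t) as H1.
      pose proof (half_step_lipschitz (iterate n) (A n) s t) as H2.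
      fold (V n) in H2.
      replace (k * V n s + forcing (U n) s - (k * V n t + forcing (U n) t))
        with (k * (V n s - V n t) + (forcing (U n) s - forcing (U n) t)) by ring.
      eapply Rle_trans; [apply Rabs_triang|].
      rewrite Rabs_mult, (Rabs_pos_eq k) by lra. nra.
    - exact Hv.
    - intros t. apply is_lim_seq_plus'.
      + apply is_lim_seq_mult'; [apply is_lim_seq_const | apply Hv].
      + apply is_lim_seq_minus'.
        * apply (is_lim_seq_continuous (F t)); [|apply Hu].
          apply continuity_pt_filterlim. apply (lipschitz_continuous K), F_lip_x.
        * apply is_lim_seq_mult'; [apply is_lim_seq_const | apply Hu]. }
  assert (Pu : periodic T u).
  { intros t. unfold u. f_equal. apply Lim_seq_ext. intros n. apply (A n). }
  assert (Pv : periodic T v).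
  { intros t. unfold v. f_equal. apply Lim_seq_ext. intros n.
    apply periodic_half_step, A. }
  exists u, (fun t => - k * u t + v t).
  split; [exact Du|]. split; [|split; [exact Pu|split]].
  (* Differentiating [- k * u + v] cancels every term in [k] and leaves [F t (u t)]. *)
  - intros t. pose proof (Du t) as D1. pose proof (Dv t) as D2.
    auto_derive; [repeat split; eexists; eassumption|].
    rewrite (is_derive_unique_eta _ _ _ D1), (is_derive_unique_eta _ _ _ D2). ring.
  - intros t. rewrite Pu, Pv. reflexivity.
  - intros t. split.
    + apply (is_lim_seq_le (fun _ => alpha) (fun n => U n t) alpha (u t));
        [intros n; apply (A n) | apply is_lim_seq_const | apply Hu].
    + apply (is_lim_seq_le (fun n => U n t) (fun _ => beta) (u t) beta);
        [intros n; apply (A n) | apply Hu | apply is_lim_seq_const].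
Qed.

End PeriodicMonotoneIteration.

(** * Periodic functions and bounds on their derivatives *)

Lemma periodic_IZR (T : R) (h : R -> R) :
  periodic T h -> forall (z : Z) (t : R), h (t + IZR z * T) = h t.
Proof.
  intros H z. induction z as [|z IH|z IH] using Z.peano_ind; intros t.
  - f_equal. ring.
  - rewrite succ_IZR, <- (IH t), <- (H (t + IZR z * T)). f_equal. ring.
  - rewrite <- (IH t), <- (H (t + IZR (Z.pred z) * T)). f_equal.
    unfold Z.pred. rewrite plus_IZR. ring.
Qed.

Lemma periodic_sin : periodic (2 * PI) sin.
Proof. intros x. rewrite <- (sin_period x 1). f_equal. simpl. ring. Qed.

Lemma periodic_cos : periodic (2 * PI) cos.
Proof. intros x. rewrite <- (cos_period x 1). f_equal. simpl. ring. Qed.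

Lemma periodic_continuous_bounded (T : R) (h : R -> R) :
  0 < T -> periodic T h -> (forall t, continuous h t) ->
  exists M, forall t, Rabs (h t) <= M.
Proof.
  intros HT Hp Hc.
  destruct (continuity_ab_maj (fun t => Rabs (h t)) 0 T) as [m [Hm _]]; [lra| |].
  - intros c _. apply continuity_pt_filterlim.
    apply (continuous_comp h Rabs); [apply Hc | apply (continuous_Rabs (h c))].
  - exists (Rabs (h m)). intros t.
    (* [up (t / T)] exceeds [t / T] by at most [1], so this translation brings [t] into [[0, T]]. *)
    rewrite <- (periodic_IZR T h Hp (1 - up (t / T)) t). apply Hm.
    rewrite minus_IZR. destruct (archimed (t / T)) as [H1 H2].
    assert (E : t = t / T * T) by (field; lra).
    set (r := t / T) in *. rewrite E. nra.
Qed.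

Lemma periodic_Derive_n (T : R) (f : R -> R) (n : nat) :
  periodic T f -> periodic T (Derive_n f n).
Proof.
  intros H t. rewrite <- Derive_n_comp_trans. apply Derive_n_ext, H.
Qed.

Lemma smooth_is_derive (f : R -> R) (n : nat) (t : R) :
  smooth f -> is_derive (Derive_n f n) t (Derive_n f (S n) t).
Proof. intros H. apply Derive_correct, (H (S n) t). Qed.

Lemma smooth_periodic_bounded (T : R) (f : R -> R) (n : nat) :
  0 < T -> smooth f -> periodic T f ->
  exists M, forall t, Rabs (Derive_n f n t) <= M.
Proof.
  intros HT Hs Hp. apply (periodic_continuous_bounded T); [exact HT| |].
  - apply periodic_Derive_n, Hp.
  - intros t. apply (ex_derive_continuous (Derive_n f n)).
    eexists. apply smooth_is_derive, Hs.
Qed.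

(** * Estimates for the pendulum equation and uniqueness on the circle *)

(** [h] stands for the second derivative of [f]. *)
Definition pendulum (l g : R) (h : R -> R) (t x : R) : R :=
  g / l * sin x - h t / l * cos x.

Lemma Rabs_sin_le (x : R) : Rabs (sin x) <= 1.
Proof. apply Rabs_le, SIN_bound. Qed.

Lemma Rabs_cos_le (x : R) : Rabs (cos x) <= 1.
Proof. apply Rabs_le, COS_bound. Qed.

Lemma pendulum_lipschitz_angle (l g M : R) (h : R -> R) (t : R) :
  0 < l -> 0 < g -> (forall s, Rabs (h s) <= M) ->
  lipschitz ((g + M) / l) (pendulum l g h t).
Proof.
  intros Hl Hg HM.
  apply (derive_bounded_lipschitz _ (fun x => g / l * cos x + h t / l * sin x)).
  - intros x. unfold pendulum. auto_derive; [exact I | ring].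
  - intros x. eapply Rle_trans; [apply Rabs_triang|]. unfold Rdiv.
    rewrite !Rabs_mult, (Rabs_pos_eq (/ l)) by (left; apply Rinv_0_lt_compat; lra).
    rewrite (Rabs_pos_eq g) by lra.
    pose proof (Rabs_sin_le x). pose proof (Rabs_cos_le x). specialize (HM t).
    pose proof (Rinv_0_lt_compat l Hl). pose proof (Rabs_pos (h t)).
    pose proof (Rabs_pos (sin x)). pose proof (Rabs_pos (cos x)).
    rewrite Rmult_plus_distr_r. apply Rplus_le_compat.
    + rewrite <- (Rmult_1_r (g * / l)) at 2. apply Rmult_le_compat_l; nra.
    + rewrite <- (Rmult_1_r (M * / l)).
      apply Rmult_le_compat; try assumption; [apply Rmult_le_pos; lra|].
      apply Rmult_le_compat_r; lra.
Qed.

Lemma pendulum_lipschitz_time (l g L : R) (h : R -> R) (x : R) :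
  0 < l -> lipschitz L h -> lipschitz (L / l) (fun t => pendulum l g h t x).
Proof.
  intros Hl HL s t. unfold pendulum.
  replace (g / l * sin x - h s / l * cos x - (g / l * sin x - h t / l * cos x))
    with (- ((h s - h t) * / l * cos x)) by (field; lra).
  pose proof (Rinv_0_lt_compat l Hl). pose proof (HL s t).
  rewrite Rabs_Ropp, !Rabs_mult, (Rabs_pos_eq (/ l)) by lra.
  pose proof (Rabs_cos_le x). pose proof (Rabs_pos (h s - h t)).
  pose proof (Rabs_pos (cos x)).
  apply Rle_trans with (Rabs (h s - h t) * / l); [|unfold Rdiv; nra].
  rewrite <- (Rmult_1_r (Rabs (h s - h t) * / l)) at 2.
  apply Rmult_le_compat_l; nra.
Qed.

(** The angle [a = atan (M / g)] satisfies [g * sin a = M * cos a]: there gravity balances the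
    largest possible inertial term, and [cos a > 0] fixes the signs. *)
Lemma pendulum_barrier (l g M : R) (h : R -> R) (t : R) :
  0 < l -> 0 < g -> (forall s, Rabs (h s) <= M) ->
  pendulum l g h t (- atan (M / g)) <= 0 <= pendulum l g h t (atan (M / g)).
Proof.
  intros Hl Hg HM. unfold pendulum. rewrite sin_neg, cos_neg.
  set (a := atan (M / g)).
  assert (C : 0 < cos a).
  { pose proof (atan_bound (M / g)) as B. fold a in B. apply cos_gt_0; lra. }
  assert (E : g * sin a = M * cos a).
  { pose proof (tan_atan (M / g)) as H. fold a in H. unfold tan in H.
    apply Rmult_eq_reg_r with (/ cos a); [|apply Rinv_neq_0_compat; lra].
    unfold Rdiv in H. rewrite (Rmult_assoc g), H. field. lra. }
  specialize (HM t). apply Rabs_le_between in HM.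
  pose proof (Rinv_0_lt_compat l Hl).
  replace (g / l * - sin a) with (/ l * - (g * sin a)) by (unfold Rdiv; ring).
  replace (g / l * sin a) with (/ l * (g * sin a)) by (unfold Rdiv; ring).
  rewrite E. split.
  - replace (/ l * - (M * cos a) - h t / l * cos a)
      with (- (/ l * ((M + h t) * cos a))) by (field; lra).
    assert (0 <= / l * ((M + h t) * cos a)); [|lra].
    apply Rmult_le_pos; [lra|]. apply Rmult_le_pos; lra.
  - replace (/ l * (M * cos a) - h t / l * cos a)
      with (/ l * ((M - h t) * cos a)) by (field; lra).
    apply Rmult_le_pos; [lra|]. apply Rmult_le_pos; lra.
Qed.

(** A lift [y] of [psi] agrees with [x] at [t0] up to [2 * PI * m]. The equation is
    [2 * PI]-periodic in the angle, so the shifted lift solves it too and equals [x] by uniqueness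
    on the line. *)
Lemma is_solution_unique (l g M t0 : R) (f : R -> R) (x p : R -> R)
    (psi : R -> circle) (q : R -> R) :
  0 < l -> 0 < g -> (forall s, Rabs (Derive_n f 2 s) <= M) ->
  (forall t, is_derive x t (p t)) ->
  (forall t, is_derive p t (pendulum l g (Derive_n f 2) t (x t))) ->
  is_solution l g f psi q -> psi t0 = angle (x t0) -> q t0 = p t0 ->
  forall t, psi t = angle (x t) /\ q t = p t.
Proof.
  intros Hl Hg HM Dx Dp [y [Hy [Dy Dq]]] E0 Eq t.
  rewrite Hy in E0. symmetry in E0. apply angle_eq in E0. destruct E0 as [m Em].
  assert (U : forall s, y s - 2 * PI * IZR m = x s /\ q s = p s).
  { apply (second_order_unique (pendulum l g (Derive_n f 2)) ((g + M) / l) t0 x p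
             (fun s => y s - 2 * PI * IZR m) q); try assumption.
    - intros s. apply pendulum_lipschitz_angle; assumption.
    - intros s. pose proof (Dy s) as D.
      auto_derive; [eexists; eassumption|].
      rewrite (is_derive_unique_eta _ _ _ D). ring.
    - intros s. unfold pendulum.
      replace (y s - 2 * PI * IZR m) with (y s + IZR (- m) * (2 * PI))
        by (rewrite opp_IZR; ring).
      rewrite (periodic_IZR _ _ periodic_sin), (periodic_IZR _ _ periodic_cos). apply Dq.
    - rewrite Em. ring. }
  destruct (U t) as [U1 U2]. split; [|exact U2].
  rewrite Hy. symmetry. apply angle_eq. exists m. lra.
Qed.

(** * The periodic solution of the pendulum equation between the barriers *)

Theorem theorem3p9 (l g T : R) (f : R -> R)
    (l_pos : 0 < l) (g_pos : 0 < g) (T_pos : 0 < T)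
    (f_smooth : smooth f) (f_periodic : periodic T f) :
  exists (phi0 : circle) (p0 : R) (phi : R -> circle) (p : R -> R),
    is_the_solution l g f 0 phi0 p0 phi p /\
    forall t : R,
      (phi t = phi (t + T) /\ p t = p (t + T)) /\
      upper_arc (phi t).
Proof.
  destruct (smooth_periodic_bounded T f 2 T_pos f_smooth f_periodic) as [M HM].
  (* A bound on the third derivative makes the second one Lipschitz, hence the equation Lipschitz in
     time. *)
  destruct (smooth_periodic_bounded T f 3 T_pos f_smooth f_periodic) as [M3 HM3].
  assert (M_nonneg : 0 <= M) by (apply Rle_trans with (2 := HM 0), Rabs_pos).
  set (a := atan (M / g)). set (K := (g + M) / l).
  assert (a_nonneg : 0 <= a).
  (* If [M = 0], both barriers collapse to the angle [0]. *)
  { unfold a. rewrite <- atan_0. destruct M_nonneg as [H|<-].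
    - left. apply atan_increasing, Rdiv_lt_0_compat; assumption.
    - right. f_equal. field. lra. }
  assert (K_pos : 0 < K) by (apply Rdiv_lt_0_compat; lra).
  (* The choice [k = sqrt K] gives [k ^ 2 = K]. *)
  destruct (periodic_solution_between (pendulum l g (Derive_n f 2)) T (M3 / l) K (sqrt K) (- a) a)
    as [x [p [Dx [Dp [Px [Pp Hx]]]]]]; try assumption.
  - apply sqrt_lt_R0, K_pos.
  - rewrite pow2_sqrt; lra.
  - lra.
  - intros x t. unfold pendulum. rewrite (periodic_Derive_n T f 2 f_periodic t). reflexivity.
  - intros x. apply pendulum_lipschitz_time; [exact l_pos|].
    apply (derive_bounded_lipschitz _ (Derive_n f 3)); [|exact HM3].
    intros t. apply smooth_is_derive, f_smooth.
  - intros t. apply pendulum_lipschitz_angle; assumption.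
  - intros t. apply pendulum_barrier; assumption.
  - intros t. apply pendulum_barrier; assumption.
  - exists (angle (x 0)), (p 0), (fun t => angle (x t)), p. split; [split|].
    + split; [|split; reflexivity]. exists x. split; [reflexivity|]. split; assumption.
    + intros psi q Hs. apply (is_solution_unique l g M 0 f); assumption.
    + intros t. rewrite Px, Pp. split; [split; reflexivity|].
      exists (x t). split; [|reflexivity].
      pose proof (atan_bound (M / g)). specialize (Hx t). fold a in H. lra.
Qed.
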